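(* Let $\mathcal H$ be a finite-dimensional real Hilbert space, $\mathcal A:\mathcal H\to2^{\mathcal H}$ a maximally monotone operator, $\mathcal Q$ a symmetric positive definite linear operator on $\mathcal H$, and $\mathcal T:=(\mathcal A+\mathcal Q)^{-1}\mathcal Q$. Let $b^0\in\mathcal H$ and let $\{b^k\}_{k\in\mathbb N}$ be generated by $b^{k+1}:=\mathcal Tb^k$. If there exists a proper, lower semi-continuous, convex function $h:\mathcal H\to\,]-\infty,+\infty]$ such that $\mathcal A=\partial h$, then the following hold. (i) (Basic convergence) The sequence $\{h(b^k)\}_{k\in\mathbb N}$ is non-increasing and converges to its minimum, which is attained at some point $b^\star\in\operatorname{Arg\,min}h$. (ii) (Ergodic rate) The objective value $h(b^k)$ converges to $h(b^\star)$ with an ergodic rate of $\mathcal O(1/k)$, i.e. $$h\Big(\frac1k\sum_{i=1}^kb^i\Big)-h(b^\star)\le\frac1{2k}\|b^0-b^\star\|_{\mathcal Q}^2 .$$ (iii) (Non-ergodic rate) The objective value $h(b^k)$ converges to $h(b^\star)$ with the non-ergodic rate of $\mathcal O(1/k)$, i.e. $$h(b^k)-h(b^\star)\le\frac1{2k}\|b^0-b^\star\|_{\mathcal Q}^2 .$$ (iv) (Precise estimate of sequential decreasing) $h(b^k)-h(b^{k+1})$ satisfies $$\|b^{k+1}-b^k\|_{\mathcal Q}^2\le h(b^k)-h(b^{k+1})\le\frac32\|b^{k-1}-b^k\|_{\mathcal Q}^2-\frac12\|b^{k+1}-b^k\|_{\mathcal Q}^2 .$$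
   Context: $\mathbb N=\{0,1,2,\dots\}$; the estimates in (ii)–(iv) are for $k\ge1$. $\|a\|_{\mathcal Q}:=\sqrt{\langle\mathcal Qa|a\rangle}$. $\partial h$ is the convex subdifferential and $\operatorname{Arg\,min}h$ the set of minimizers of $h$. $a=\mathcal Tb$ means $\mathcal Qb\in\mathcal Aa+\mathcal Qa$; for $\mathcal A=\partial h$ this reads $\mathcal Tb=\arg\min_xh(x)+\frac12\|x-b\|_{\mathcal Q}^2$. In (ii) and (iii), $b^\star$ is the point in (i).
   Formalization: The claims about b* (convergence of h(b^k) to the attained minimum in (i), and (ii), (iii)) are proved under the added assumption that Arg min h is nonempty, which can fail (h = exp on the real line, Q = id); monotonicity in (i) and all of (iv) need no such assumption. *)

(* Defs.v *)
From HB Require Import structures.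
From mathcomp Require Import all_boot all_order all_algebra.
From mathcomp Require Import sesquilinear.
From mathcomp Require Import all_classical all_reals all_analysis.

Set Implicit Arguments.
Unset Strict Implicit.
Unset Printing Implicit Defensive.
Import Order.TTheory GRing.Theory Num.Theory.
Import numFieldNormedType.Exports.
Local Open Scope classical_set_scope.
Local Open Scope ring_scope.

Section HilbertSpace.
Context {R : realType} {H : normedModType R}.
Implicit Types (dot : {dot H for idfun}) (Q : {linear H -> H}).

Definition finite_dimensional (V : lmodType R) : Prop :=
  exists (n : nat) (e : 'I_n -> V),
    forall x, exists c : 'I_n -> R, x = \sum_(i < n) c i *: e i.

(* The library has no inner product spaces: this ties the norm (hence the
   topology) of H to the inner product. *)
Definition norm_induced_by dot : Prop :=
  forall x, `|x| = Num.sqrt (dot x x).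

Definition symmetric_op dot Q : Prop :=
  forall x y, dot (Q x) y = dot x (Q y).

Definition positive_definite_op dot Q : Prop :=
  forall x, x != 0 -> 0 < dot (Q x) x.

Definition normQ dot Q (a : H) : R := Num.sqrt (dot (Q a) a).

End HilbertSpace.

Section SetValuedOperators.
Context {R : realType} {H : normedModType R}.
Implicit Types (dot : {dot H for idfun}) (A B : H -> set H).

Definition monotone_op dot A : Prop :=
  forall x y u v, A x u -> A y v -> 0 <= dot (x - y) (u - v).

Definition maximally_monotone dot A : Prop :=
  monotone_op dot A /\
  forall B, monotone_op dot B -> (forall x, A x `<=` B x) -> B = A.

Definition op_add A B (x : H) : set H :=
  [set w | exists u v, [/\ A x u, B x v & w = u + v]].

Definition op_inv A (u : H) : set H := [set x | A x u].

(* T = (A + Q)^-1 Q, as a set-valued operator; [T_op A Q b a] reads a = T b. *)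
Definition T_op A (Q : {linear H -> H}) (b : H) : set H :=
  op_inv (op_add A (fun x => [set Q x])) (Q b).

End SetValuedOperators.

Section ConvexAnalysis.
Context {R : realType} {H : normedModType R}.
Implicit Types (dot : {dot H for idfun}) (h : H -> \bar R).
Local Open Scope ereal_scope.

Definition proper_fun h : Prop :=
  (forall x, h x != -oo) /\ exists x, h x < +oo.

(* Only used for functions that avoid -oo, so that the right-hand side never
   involves +oo + -oo; recall that 0 * +oo = 0 in \bar R. *)
Definition convex_efun h : Prop :=
  forall (x y : H) (t : R), (0 <= t <= 1)%R ->
    h (t *: x + (1 - t) *: y)%R <= t%:E * h x + (1 - t)%:E * h y.

(* For a proper h this set is empty whenever h x = +oo, as it should be. *)
Definition subdifferential dot h (x : H) : set H :=
  [set u | forall y, h x + (dot u (y - x)%R)%:E <= h y].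

Definition Argmin h : set H := [set x | forall y, h x <= h y].

End ConvexAnalysis.

(* Main.v *)
(** The subgradient inequality at [a = T b] for [u = Q (b - a)], polarized in
    the Q-norm, is the three-point inequality
      h a + (|b - a|^2 + |y - a|^2 - |b - y|^2) / 2 <= h y    for all y.
    With [y = b] it gives the decrease of [h] along the iteration. With a
    minimizer [y], it telescopes to
      sum_{i <= k} (h (b i) - h y) <= |b 0 - y|^2 / 2,
    whence both rates, by Jensen's inequality and by monotonicity. Written at
    [b k] with [y = b k.+1], it gives the upper bound on the decrease. *)

Require Import Defs.
From HB Require Import structures.
From mathcomp Require Import all_boot all_order all_algebra.
From mathcomp Require Import sesquilinear.
From mathcomp Require Import all_classical all_reals all_analysis.
From mathcomp Require Import lra.

Set Implicit Arguments.
Unset Strict Implicit.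
Unset Printing Implicit Defensive.
Import Order.TTheory GRing.Theory Num.Theory.
Import numFieldNormedType.Exports.
Local Open Scope classical_set_scope.
Local Open Scope ring_scope.

Section QuadraticForm.
Context {R : realType} {H : normedModType R}.
Variables (dot : {dot H for idfun}) (Q : {linear H -> H}).
Hypotheses (Q_sym : symmetric_op dot Q) (Q_posdef : positive_definite_op dot Q).

Lemma dotQ_ge0 a : 0 <= dot (Q a) a.
Proof.
have [->|/Q_posdef/ltW//] := eqVneq a 0.
by rewrite linear0r lexx.
Qed.

Lemma normQ_sqr a : normQ dot Q a ^+ 2 = dot (Q a) a.
Proof. by rewrite sqr_sqrtr// dotQ_ge0. Qed.

Lemma dotQC x y : dot (Q x) y = dot (Q y) x.
Proof. by rewrite Q_sym hermC expr0 mul1r. Qed.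

Lemma dotQ_polarization x y :
  dot (Q x) y = 2^-1 * (normQ dot Q x ^+ 2 + normQ dot Q y ^+ 2
                        - normQ dot Q (x - y) ^+ 2).
Proof.
rewrite !normQ_sqr (linearB Q) linearBl !linearBr /= (dotQC y x); lra.
Qed.

(** The parallelogram law, with the nonnegative term in [x + y] dropped. *)
Lemma normQB_sqr_le x y :
  normQ dot Q (x - y) ^+ 2
  <= 2 * normQ dot Q x ^+ 2 + 2 * normQ dot Q y ^+ 2.
Proof.
have := dotQ_ge0 (x + y).
rewrite !normQ_sqr (linearB Q) (linearD Q) !linearDl linearNl !linearDr !linearNr.
rewrite /= (dotQC y x); lra.
Qed.

Lemma normQ0 : normQ dot Q 0 = 0.
Proof. by rewrite /normQ linear0r sqrtr0. Qed.

Lemma normQBC x y : normQ dot Q (x - y) = normQ dot Q (y - x).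
Proof. by rewrite /normQ -opprB (linearN Q) linearNl linearNr opprK. Qed.

End QuadraticForm.

Section ExtendedConvex.
Context {R : realType} {H : normedModType R}.
Variable h : H -> \bar R.
Local Open Scope ereal_scope.

(** Real bounds [c] and [d] in place of the values of [h] keep the right-hand side in [R]. *)
Lemma convex_efun_le x y (t c d : R) : convex_efun h -> (0 <= t <= 1)%R ->
  h x <= c%:E -> h y <= d%:E ->
  h (t *: x + (1 - t) *: y)%R <= (t * c + (1 - t) * d)%:E.
Proof.
move=> h_convex t01 hx hy; apply: le_trans (h_convex x y t t01) _.
case/andP: t01 => t0 t1.
by rewrite [leRHS]EFinD !EFinM leeD// lee_wpmul2l// lee_fin ?subr_ge0.
Qed.

Lemma convex_efun_mean (x : nat -> H) (c : nat -> R) k : convex_efun h ->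
  (forall i, h (x i) <= (c i)%:E) ->
  h (k.+1%:R^-1 *: \sum_(i < k.+1) x i)%R
  <= (k.+1%:R^-1 * \sum_(i < k.+1) c i)%R%:E.
Proof.
move=> h_convex hx; elim: k => [|k IHk].
  by rewrite !big_ord1 invr1 scale1r mul1r.
(* The mean of [k.+2] points is the convex combination of the mean of the first [k.+1], with weight
   [t], and the last point, with weight [1 - t]. *)
pose t : R := (k.+1%:R / k.+2%:R)%R.
have k1 : k.+1%:R != 0%R :> R by rewrite pnatr_eq0.
have k2 : k.+2%:R != 0%R :> R by rewrite pnatr_eq0.
have t01 : (0 <= t <= 1)%R.
  by rewrite divr_ge0//= ler_pdivrMr ?ltr0n// mul1r ler_nat.
have tE : (1 - t = k.+2%:R^-1)%R.
  apply: (mulIf k2); rewrite mulrBl mul1r divfK// mulVf// -natrB//.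
  by rewrite subSnn.
have ti : (t * k.+1%:R^-1 = k.+2%:R^-1)%R by rewrite /t mulrAC mulfV// mul1r.
rewrite [in leRHS]big_ord_recr [in leLHS]big_ord_recr/=.
have := convex_efun_le h_convex t01 IHk (hx k.+1).
by rewrite tE scalerA mulrA ti -scalerDr -mulrDr.
Qed.

End ExtendedConvex.

Section ProximalPoint.
Context {R : realType} {H : normedModType R}.
Variables (dot : {dot H for idfun}) (Q : {linear H -> H}) (h : H -> \bar R).
Hypotheses (Q_sym : symmetric_op dot Q) (Q_posdef : positive_definite_op dot Q).
Hypothesis h_proper : proper_fun h.
Local Notation A := (subdifferential dot h).
Local Notation "`[ a ]Q" := (normQ dot Q a ^+ 2) (format "`[ a ]Q") : ring_scope.
Local Open Scope ereal_scope.

Lemma T_op_three_point a b y : T_op A Q b a ->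
  h a + (2^-1 * (`[b - a]Q + `[y - a]Q - `[b - y]Q))%R%:E <= h y.
Proof.
case=> u [_ [Au -> Qb]].
have uE : u = Q (b - a)%R by rewrite (linearB Q) Qb addrK.
by have := Au y; rewrite uE dotQ_polarization// opprB addrA subrK.
Qed.

Lemma Argmin_fin_num x : Argmin h x -> h x \is a fin_num.
Proof.
case: h_proper => h_noo [y hy] hx; rewrite fin_numE h_noo/=.
by rewrite -ltey (le_lt_trans (hx y) hy).
Qed.

(** If [h a] were [+oo], the three-point inequality would force [h y = +oo] for every [y], against
    properness. *)
Lemma T_op_fin_num a b : T_op A Q b a -> h a \is a fin_num.
Proof.
case: h_proper => h_noo [y hy] /(T_op_three_point y) hay.
rewrite fin_numE h_noo/=; apply/eqP => ha.
by move: hay; rewrite ha addye// leye_eq => /eqP hyE; rewrite hyE in hy.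
Qed.

Lemma T_op_decrease a b : T_op A Q b a -> h a + (`[b - a]Q)%:E <= h b.
Proof.
move=> /(T_op_three_point b); rewrite subrr normQ0 expr0n subr0.
by have -> : (2^-1 * (`[b - a]Q + `[b - a]Q) = `[b - a]Q)%R by lra.
Qed.

Lemma T_op_le a b : T_op A Q b a -> h a <= h b.
Proof.
move=> /T_op_decrease; apply: le_trans.
by rewrite leeDl// lee_fin sqr_ge0.
Qed.

Lemma T_op_decrease_le a b c : T_op A Q c b -> T_op A Q b a ->
  h b - h a <= (3 / 2 * `[c - b]Q - 1 / 2 * `[a - b]Q)%R%:E.
Proof.
move=> Tcb Tba.
(* Let p and q be the squared Q-norms of [c - b] and [a - b]. The three-point inequality and the
   parallelogram bound on [c - a] give [h b - h a] <= (p + q) / 2. Since the decrease gives q <=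
   [h b - h a], it follows that q <= p, and adding p - q to the bound yields 3/2 p - 1/2 q. *)
move: (T_op_three_point a Tcb) (T_op_decrease Tba).
rewrite -(fineK (T_op_fin_num Tba)) -(fineK (T_op_fin_num Tcb)).
rewrite -!EFinD !lee_fin (normQBC _ _ b a).
have := normQB_sqr_le Q_sym Q_posdef (c - b) (a - b).
rewrite opprB addrA subrK; lra.
Qed.

Section Iteration.
Variable b : nat -> H.
Hypothesis b_iter : forall k, T_op A Q (b k) (b k.+1).

(** The index starts at 1 because [b 0] is arbitrary and [h (b 0)] may be [+oo]. *)
Lemma iter_fin_num k : h (b k.+1) \is a fin_num.
Proof. exact: T_op_fin_num (b_iter k). Qed.

Lemma iter_nonincreasing : nonincreasing_seq (fun k => h (b k)).
Proof. by apply/nonincreasing_seqP => k; exact: T_op_le. Qed.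

Variable bstar : H.
Hypothesis bstar_min : Argmin h bstar.

(** Keeping the distance from [b k] to [bstar] on the right lets the induction telescope; only the
    squared step lengths are discarded. *)
Lemma iter_sum_gap_le k :
  (\sum_(i < k) (fine (h (b i.+1)) - fine (h bstar)) <=
   2^-1 * (`[b 0%N - bstar]Q - `[b k - bstar]Q))%R.
Proof.
elim: k => [|k IHk]; first by rewrite big_ord0 subrr mulr0.
rewrite big_ord_recr/=.
have := T_op_three_point bstar (b_iter k).
rewrite -(fineK (iter_fin_num k)) -(fineK (Argmin_fin_num bstar_min)).
rewrite -EFinD lee_fin (normQBC _ _ bstar).
have := sqr_ge0 (normQ dot Q (b k - b k.+1)%R); lra.
Qed.

(** Common source of both rates: the mean of the values dominates the value at the mean as well as
    the last value. *)
Lemma iter_mean_gap_le k :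
  (k.+1%:R^-1 * \sum_(i < k.+1) fine (h (b i.+1)) - fine (h bstar) <=
   (2 * k.+1%:R)^-1 * `[b 0%N - bstar]Q)%R.
Proof.
have k0 : (0 < k.+1%:R :> R)%R by rewrite ltr0n.
rewrite -(ler_pM2l k0) mulrBr mulVKf ?gt_eqF// invfM mulrA.
rewrite [X in (_ <= X * _)%R]mulrC mulfVK ?gt_eqF//.
have := iter_sum_gap_le k.+1; rewrite sumrB sumr_const card_ord -mulr_natl.
have := sqr_ge0 (normQ dot Q (b k.+1 - bstar)%R); lra.
Qed.

Lemma iter_ergodic_rate k : convex_efun h ->
  h (k.+1%:R^-1 *: \sum_(i < k.+1) b i.+1)%R - h bstar
  <= ((2 * k.+1%:R)^-1 * `[b 0%N - bstar]Q)%R%:E.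
Proof.
move=> h_convex; have fs := Argmin_fin_num bstar_min.
rewrite leeBlDr//.
have hb i : h (b i.+1) <= (fine (h (b i.+1)))%:E by rewrite fineK// iter_fin_num.
apply: le_trans (convex_efun_mean (x := b \o succn) k h_convex hb) _.
by rewrite -(fineK fs) -EFinD lee_fin -lerBlDr iter_mean_gap_le.
Qed.

Lemma iter_rate k :
  h (b k.+1) - h bstar <= ((2 * k.+1%:R)^-1 * `[b 0%N - bstar]Q)%R%:E.
Proof.
rewrite -(fineK (iter_fin_num k)) -(fineK (Argmin_fin_num bstar_min)).
rewrite -EFinB lee_fin; apply: le_trans (iter_mean_gap_le k).
(* Once the factor [k.+1] is cleared, [k.+1] copies of the last value, the smallest one, are
   compared with the sum term by term. *)
rewrite lerD2r -(ler_pM2l (ltr0n R k.+1)) mulVKf ?pnatr_eq0//.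
rewrite mulr_natl -[X in (_ *+ X)%R]card_ord -sumr_const; apply: ler_sum => i _.
by apply: fine_le; rewrite ?iter_fin_num//; apply: iter_nonincreasing; rewrite ltnS -ltnS.
Qed.

Lemma iter_cvg : h (b k) @[k --> \oo] --> h bstar.
Proof.
(* Dropping [h (b 0)] leaves the indices at which the rate applies. *)
rewrite -(cvg_shiftS (fun k => h (b k))).
have fs := Argmin_fin_num bstar_min.
pose C := (2^-1 * `[b 0%N - bstar]Q)%R.
(* Minimality bounds the values below; the rate bounds them above, [harmonic k] being 1 / (k +
   1). *)
apply: (@squeeze_cvge _ _ _ _ (fun=> h bstar) _
  (fun k => (harmonic k * C + fine (h bstar))%R%:E)).
- apply: nearW => k; rewrite bstar_min/= EFinD fineK// -leeBlDr//.
  by rewrite /C mulrA [(_^-1 * _)%R]mulrC -invfM iter_rate.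
- exact: cvg_cst.
- rewrite -[in X in _ --> X](fineK fs) -[in X in _ --> X](add0r (fine _)).
  apply: cvg_EFin; first exact: nearW.
  apply: cvgD; last exact: cvg_cst.
  by rewrite -[X in _ --> X](mul0r C); apply: cvgMl; exact: cvg_harmonic.
Qed.

End Iteration.
End ProximalPoint.

Theorem theorem3p2 (R : realType) (H : completeNormedModType R)
    (dot : {dot H for idfun})
    (H_inner : norm_induced_by dot)
    (H_findim : finite_dimensional H)
    (A : H -> set H) (A_maxmon : maximally_monotone dot A)
    (Q : {linear H -> H})
    (Q_sym : symmetric_op dot Q) (Q_posdef : positive_definite_op dot Q)
    (b : nat -> H) (b_iter : forall k : nat, T_op A Q (b k) (b k.+1))
    (h : H -> \bar R)
    (h_proper : proper_fun h) (h_lsc : lower_semicontinuous h)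
    (h_convex : convex_efun h)
    (A_subdiff : A = subdifferential dot h) :
  (* (i), monotonicity *)
  nonincreasing_seq (fun k => h (b k)) /\
  (Argmin h !=set0 ->
   exists bstar : H,
     [/\ (* (i), convergence to the attained minimum *)
         Argmin h bstar /\ (h (b k) @[k --> \oo] --> h bstar),
         (* (ii) *)
         forall k : nat, (1 <= k)%N ->
           (h (k%:R^-1 *: \sum_(1 <= i < k.+1) b i) - h bstar
            <= ((2 * k%:R)^-1 * normQ dot Q (b 0%N - bstar) ^+ 2)%:E)%E
       & (* (iii) *)
         forall k : nat, (1 <= k)%N ->
           (h (b k) - h bstar
            <= ((2 * k%:R)^-1 * normQ dot Q (b 0%N - bstar) ^+ 2)%:E)%E]) /\
  (* (iv) *)
  (forall k : nat, (1 <= k)%N ->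
     ((normQ dot Q (b k.+1 - b k) ^+ 2)%:E <= h (b k) - h (b k.+1))%E /\
     (h (b k) - h (b k.+1)
      <= (3 / 2 * normQ dot Q (b k.-1 - b k) ^+ 2
          - 1 / 2 * normQ dot Q (b k.+1 - b k) ^+ 2)%:E)%E).
Proof.
subst A; split; first exact: iter_nonincreasing b_iter.
split=> [[bstar bstar_min]|[//|k] _ /=].
  (* Any minimizer serves as the witness, since the estimates hold for each of them. *)
  exists bstar; split=> [|[//|k] _|[//|k] _].
  - by split=> //; exact: iter_cvg b_iter _ bstar_min.
  - by rewrite big_add1 big_mkord; exact: iter_ergodic_rate.
  - exact: iter_rate.
split; last exact: T_op_decrease_le (b_iter k) (b_iter k.+1).
rewrite leeBrDr ?(iter_fin_num _ _ _ b_iter)// addeC normQBC.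
exact: T_op_decrease (b_iter k.+1).
Qed.
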